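(* Let $A$ be a real matrix with term rank equal to $t$. If the rank of $A$ is at least $t-2$, then there is a matrix with rational entries which has the same size, the same sign pattern and the same rank as $A$.
   Context: A line of a matrix is any of its rows or columns. The term rank of a matrix $A$ is the smallest number of lines needed to include all the nonzero entries of $A$. The sign pattern of a real matrix $A\in\mathbb{R}^{m\times n}$ is the matrix $S\in\{+,-,0\}^{m\times n}$ with $S_{ij}=+$ if $A_{ij}>0$, $S_{ij}=-$ if $A_{ij}<0$, and $S_{ij}=0$ if $A_{ij}=0$. *)

(* Defs.v *)
From mathcomp Require Import all_boot all_order all_algebra.
From mathcomp Require Import reals.

Set Implicit Arguments.
Unset Strict Implicit.
Unset Printing Implicit Defensive.

Import Order.TTheory GRing.Theory Num.Theory.
Local Open Scope ring_scope.

(* A set of lines of an m x n matrix: inl i is row i, inr j is column j. *)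
Definition covers_nonzeros (R : nmodType) (m n : nat) (A : 'M[R]_(m, n))
    (L : {set 'I_m + 'I_n}) : bool :=
  [forall i, forall j, (A i j != 0) ==> ((inl i \in L) || (inr j \in L))].

(* The set of all lines is a cover, so the minimum ranges over a nonempty
   family. *)
Definition term_rank (R : nmodType) (m n : nat) (A : 'M[R]_(m, n)) : nat :=
  #|[arg min_(L < [set: 'I_m + 'I_n] | covers_nonzeros A L) #|L|]%N|.

Lemma covers_nonzerosT (R : nmodType) (m n : nat) (A : 'M[R]_(m, n)) :
  covers_nonzeros A [set: 'I_m + 'I_n].
Proof. by apply/forallP=> i; apply/forallP=> j; rewrite !inE implybT. Qed.

Lemma term_rankP (R : nmodType) (m n : nat) (A : 'M[R]_(m, n)) :
  (exists2 L, covers_nonzeros A L & #|L| = term_rank A) /\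
  (forall L, covers_nonzeros A L -> (term_rank A <= #|L|)%N).
Proof.
rewrite /term_rank; case: arg_minnP => [|L covL minL].
  exact: covers_nonzerosT.
by split=> //; exists L.
Qed.

(* The signs +, -, 0 are encoded as the integers 1, -1, 0. *)
Definition sign_pattern (R : realDomainType) (m n : nat) (A : 'M[R]_(m, n)) :
    'M[int]_(m, n) :=
  map_mx (@sgz R) A.

(* Main.v *)
Require Import Defs.
From mathcomp Require Import all_boot all_order all_algebra.
From mathcomp Require Import reals.
From mathcomp Require Import ring lra zify.

Set Implicit Arguments.
Unset Strict Implicit.
Unset Printing Implicit Defensive.

Import Order.TTheory GRing.Theory Num.Theory.
Local Open Scope ring_scope.

(** View A as a bilinear form, and call a pair (U, V) of row spaces isotropic
    when U A V^T = 0.  Isotropic pairs certify upper bounds on the rank, since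
    rank A <= codim U + codim V ([mxrank_isotropic_le]), and every isotropic
    pair extends to one for which this is an equality ([isotropic_extension]).

    A cover of the nonzero entries by t lines is an isotropic pair (S, T) of
    coordinate subspaces with codim S + codim T = t.  If rank A >= t - 2, the
    extended pair (U, V) satisfies dim U/S + dim V/T <= 2, so it is almost a
    pair of coordinate subspaces, hence almost rational.

    Suppose first that U, V are rational.  The matrices B that vanish where A
    does and satisfy U B V^T = 0 form a real solution space of a rational
    linear system, so its rational points are dense.  A rational B close to A
    has the signs of A, has rank at least rank A because rank is lower
    semicontinuous, and has rank at most codim U + codim V = rank A.  More
    generally it is enough that A is a limit of matrices A' having rational
    isotropic pairs of the same dimensions ([realizable_of_approx]).

    It remains to make (U, V) rational.  Multiplying rows and columns of A by
    positive numbers changes neither the signs nor the rank.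
    - If dim U/S <= 1 and dim V/T <= 1, each extra dimension is spanned by one
      vector, and scaling turns its entries into signs
      ([rational_up_to_scale]).
    - If dim U/S = 2, then V = T is already rational, and U is S plus the row
      space of a matrix with two rows.  A shear and a scaling turn each column
      of that matrix into s (1, x) with s in {-1, 0, 1}
      ([planar_normal_form]).  The numbers x are moved to nearby rational ones,
      equal ones staying equal; every column of A that was orthogonal to the
      two rows can then be repaired by small changes at two of its nonzero
      entries ([planar_column]).
    - The case dim V/T = 2 follows by transposition. *)

(** * Isotropic pairs and rank *)
Lemma mxrank_isotropic_le (F : fieldType) (m n k l : nat) (A : 'M[F]_(m, n))
    (U : 'M_(k, m)) (V : 'M_(l, n)) :
  U *m A *m V^T = 0 -> (\rank A + \rank U + \rank V <= m + n)%N.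
Proof.
move=> UAV.
have sU : (U <= kermx (A *m V^T))%MS by apply/sub_kermxP; rewrite mulmxA.
have := mxrankS sU; have := mxrankS (capmxSr A (kermx V^T)).
rewrite !mxrank_ker mxrank_tr -(mxrank_mul_ker A V^T).
have := rank_leq_row (A *m V^T); have := rank_leq_col V.
by lia.
Qed.

(** Take U to be the left kernel of A V0^T, and V the right kernel of U A.  Since
    U contains the left kernel of A, rank (U A) = rank A - rank (A V0^T), so the
    two codimensions add up to rank A. *)
Lemma isotropic_extension (F : fieldType) (m n k l : nat) (A : 'M[F]_(m, n))
    (U0 : 'M_(k, m)) (V0 : 'M_(l, n)) :
  U0 *m A *m V0^T = 0 ->
  exists (U : 'M_m) (V : 'M_n),
    [/\ (U0 <= U)%MS, (V0 <= V)%MS, U *m A *m V^T = 0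
      & (\rank A + \rank U + \rank V = m + n)%N].
Proof.
move=> UAV0; pose U := kermx (A *m V0^T); pose V := kermx (U *m A)^T.
have sU0 : (U0 <= U)%MS by apply/sub_kermxP; rewrite mulmxA.
have sV0 : (V0 <= V)%MS.
  apply/sub_kermxP/trmx_inj.
  by rewrite trmx_mul trmxK trmx0 -mulmxA mulmx_ker.
exists U, V; split=> //; first by apply: trmx_inj; rewrite trmx_mul trmxK mulmx_ker trmx0.
have kerAU : (U :&: kermx A :=: kermx A)%MS.
  apply/eqmxP; rewrite capmxSr sub_capmx submx_refl andbT.
  by apply/sub_kermxP; rewrite mulmxA mulmx_ker mul0mx.
have := mxrank_mul_ker U A; rewrite kerAU !mxrank_ker !mxrank_tr.
have := rank_leq_col (U *m A); have := rank_leq_row A; have := rank_leq_row (A *m V0^T).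
by lia.
Qed.

Lemma submx_complement (F : fieldType) (m u k : nat) (U0 : 'M[F]_(k, m)) (U : 'M_m) :
  (U0 <= U)%MS -> \rank U = (\rank U0 + u)%N ->
  exists L : 'M_(u, m), (U :=: col_mx U0 L)%MS.
Proof.
move=> sU rU.
have cU : (U :&: U0 :=: U0)%MS by apply/capmx_idPr.
have rD : \rank (U :\: U0) = u.
  by have := mxrank_cap_compl U U0; rewrite cU rU; lia.
have [L eL] : exists L : 'M_(u, m), (L :=: U :\: U0)%MS.
  by rewrite -rD; exists (row_base (U :\: U0)%MS); apply: eq_row_base.
exists L; apply: eqmx_trans (eqmx_sym (addsmx_diff_cap_eq U U0)) _.
by apply: eqmx_trans (addsmxE _ _); rewrite addsmxC; apply: adds_eqmx => //; apply: eqmx_sym.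
Qed.

(** * Coordinate subspaces *)
Definition coordmx (F : nzRingType) (n : nat) (S : {set 'I_n}) : 'M[F]_(#|S|, n) :=
  rowsub enum_val 1%:M.

Lemma mxrank_coordmx (F : fieldType) n (S : {set 'I_n}) :
  \rank (coordmx F S) = #|S|.
Proof.
apply/eqP/row_freeP; exists (coordmx F S)^T; apply/matrixP => i j.
rewrite /coordmx mul_rowsub_mx mul1mx !mxE eq_sym.
by rewrite (inj_eq enum_val_inj) eq_sym.
Qed.

Lemma map_coordmx (F K : nzRingType) (f : {rmorphism F -> K}) n (S : {set 'I_n}) :
  map_mx f (coordmx F S) = coordmx K S.
Proof. by rewrite /coordmx map_mxsub map_mx1. Qed.

Lemma mul_coordmx (F : nzRingType) n p (S : {set 'I_n}) (A : 'M[F]_(n, p)) :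
  coordmx F S *m A = rowsub enum_val A.
Proof. by rewrite mul_rowsub_mx mul1mx. Qed.

Lemma mul_mx_coordmxT (F : comNzRingType) n p (S : {set 'I_n}) (A : 'M[F]_(p, n)) :
  A *m (coordmx F S)^T = colsub enum_val A.
Proof. by apply: trmx_inj; rewrite trmx_mul trmxK mul_coordmx; apply/matrixP=> i j; rewrite !mxE. Qed.

(** * Small perturbations do not lower the rank *)
Definition close_mx (R : numDomainType) m n (e : R) (A B : 'M[R]_(m, n)) :=
  forall i j, `|B i j - A i j| <= e.

Definition zeros_kept (R S : nmodType) m n (A : 'M[R]_(m, n)) (B : 'M[S]_(m, n)) :=
  forall i j, A i j = 0 -> B i j = 0.

(** The constant is crude; what matters is that it depends on [G] and [H] only. *)
Lemma close_mulmx (R : numDomainType) m n p q (G : 'M[R]_(p, m)) (H : 'M[R]_(n, q))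
    (A B : 'M[R]_(m, n)) e :
  0 <= e -> close_mx e A B ->
  close_mx (e * ((\sum_i \sum_j `|G i j|) * (\sum_i \sum_j `|H i j|)))
    (G *m A *m H) (G *m B *m H).
Proof.
move=> e_ge0 closeAB i j.
have -> : (G *m B *m H) i j - (G *m A *m H) i j = (G *m (B - A) *m H) i j.
  by rewrite mulmxBr mulmxBl !mxE.
have leG : \sum_k `|G i k| <= \sum_i' \sum_k `|G i' k|.
  by rewrite [leRHS](bigD1 i) //= lerDl !sumr_ge0 // => ? _; rewrite sumr_ge0.
have leH : \sum_k `|H k j| <= \sum_k \sum_j' `|H k j'|.
  by apply: ler_sum => k _; rewrite (bigD1 j) //= lerDl sumr_ge0.
have -> : (G *m (B - A) *m H) i j = \sum_l \sum_k G i k * (B - A) k l * H l j.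
  by rewrite mxE; apply: eq_bigr => l _; rewrite mxE mulr_suml.
apply: (@le_trans _ _ (\sum_l \sum_k `|G i k| * e * `|H l j|)).
  apply: le_trans (ler_norm_sum _ _ _) (ler_sum _ _) => l _.
  apply: le_trans (ler_norm_sum _ _ _) (ler_sum _ _) => k _.
  rewrite !normrM ler_wpM2r // ler_wpM2l // !mxE; exact: closeAB.
have -> : \sum_l \sum_k `|G i k| * e * `|H l j| =
    e * ((\sum_k `|G i k|) * (\sum_k `|H k j|)).
  rewrite [in RHS]mulr_sumr mulr_sumr; apply: eq_bigr => l _.
  by rewrite mulr_suml mulr_sumr; apply: eq_bigr => k _; rewrite mulrCA mulrA.
by rewrite ler_wpM2l // ler_pM // sumr_ge0.
Qed.

(** A row vector v with v B = 0 satisfies v = - v (B - 1), whence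
    |v|_1 <= e r |v|_1, where |v|_1 is the sum of the absolute values. *)
Lemma unitmx_near1 (R : realFieldType) r (B : 'M[R]_r) e :
  close_mx e 1%:M B -> e * r%:R < 1 -> B \in unitmx.
Proof.
move=> closeB er; rewrite -row_free_unit -kermx_eq0; apply/rowV0P => v /sub_kermxP vB.
pose S := \sum_j `|v 0 j|.
have S_ge0 : 0 <= S by apply: sumr_ge0.
have S_le : S <= e * r%:R * S.
  have -> : e * r%:R * S = \sum_(j < r) \sum_i `|v 0 i| * e.
    by rewrite sumr_const card_ord -mulr_suml -/S -mulr_natr; ring.
  apply: ler_sum => j _.
  have -> : v 0 j = - \sum_i v 0 i * (B i j - (1%:M : 'M_r) i j).
    under eq_bigr do rewrite mulrBr.
    rewrite sumrB; have := congr1 (fun M : 'rV_r => M 0 j) vB; rewrite !mxE => ->.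
    by have := congr1 (fun M : 'rV_r => M 0 j) (mulmx1 v); rewrite mxE => ->; rewrite sub0r opprK.
  rewrite normrN; apply: le_trans (ler_norm_sum _ _ _) (ler_sum _ _) => i _.
  by rewrite normrM ler_wpM2l.
have S0 : S = 0 by nra.
apply/rowP => j; rewrite mxE; apply/eqP; rewrite -normr_eq0.
by apply/eqP; move: j (isT : true); apply/psumr_eq0P.
Qed.

(** With r = rank A, there are G, H such that G A H is the identity of size r;
    then G B H is invertible for every B close to A. *)
Lemma mxrank_lsc (R : realFieldType) m n (A : 'M[R]_(m, n)) :
  exists2 e, 0 < e & forall B, close_mx e A B -> (\rank A <= \rank B)%N.
Proof.
have [G GA] : exists G, G *m col_base A = 1%:M by apply/row_fullP/col_base_full.
have [H AH] : exists H, row_base A *m H = 1%:M by apply/row_freeP/row_base_free.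
have GAH : G *m A *m H = 1%:M.
  have : G *m (col_base A *m row_base A) *m H = 1%:M by rewrite mulmxA GA mul1mx AH.
  by rewrite mulmx_base.
set c := (\sum_i \sum_j `|G i j|) * (\sum_i \sum_j `|H i j|).
have c_ge0 : 0 <= c.
  by apply: mulr_ge0; apply: sumr_ge0 => ? _; apply: sumr_ge0.
have cr_gt0 : 0 < c * (\rank A)%:R + 1 by rewrite ltr_wpDl // mulr_ge0.
exists (c * (\rank A)%:R + 1)^-1 => [|B closeAB]; first by rewrite invr_gt0.
have e_ge0 : 0 <= (c * (\rank A)%:R + 1)^-1 by rewrite invr_ge0 ltW.
have := close_mulmx G H e_ge0 closeAB; rewrite -/c GAH => /unitmx_near1 unitGBH.
rewrite -[X in (X <= _)%N](mxrank_unit (unitGBH _)).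
  by rewrite -mulmxA mulmxA; apply: leq_trans (mxrankM_maxl _ _) (mxrankM_maxr _ _).
by rewrite -mulrA mulrC ltr_pdivrMr // mul1r ltrDl.
Qed.

(** * Rational solutions of rational systems are dense *)

(** That the approximation is a function will ensure that equal numbers have
    equal approximations. *)
Lemma rat_approx (R : archiRealFieldType) (e : R) :
  0 < e -> exists q : R -> rat, forall x, `|ratr (q x) - x| <= e.
Proof.
move=> e0.
have ex x : exists q : rat, ratr q \in `]x - e, x + e[.
  by apply: rat_in_itvoo; lra.
exists (fun x => xchoose (ex x)) => x; have := xchooseP (ex x).
by rewrite in_itv /= ler_distl => /andP[? ?]; rewrite !ltW.
Qed.

(** The kernel of a rational matrix has a rational spanning family, so it is
    enough to approximate the coefficients on that family. *)
Lemma rat_kernel_dense (R : archiRealFieldType) N K (S : 'M[rat]_(N, K))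
    (x : 'rV[R]_N) e :
  x *m map_mx ratr S = 0 -> 0 < e ->
  exists2 y : 'rV[rat]_N, y *m S = 0 & close_mx e x (map_mx ratr y).
Proof.
move=> /sub_kermxP; rewrite -map_kermx => /submxP[D ->] e_gt0.
pose H : 'M[R]_N := map_mx ratr (kermx S).
pose c := (\sum_i \sum_j `|(1%:M : 'M[R]_1) i j|) * (\sum_i \sum_j `|H i j|).
have c_ge0 : 0 <= c.
  by apply: mulr_ge0; apply: sumr_ge0 => ? _; apply: sumr_ge0.
have d_gt0 : 0 < e / (c + 1) by rewrite divr_gt0 // ltr_wpDl.
have [q qP] := rat_approx d_gt0.
exists (map_mx q D *m kermx S); first by rewrite -mulmxA mulmx_ker mulmx0.
have closeD : close_mx (e / (c + 1)) D (map_mx ratr (map_mx q D)).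
  by move=> i j; rewrite !mxE.
have -> : map_mx ratr (map_mx q D *m kermx S) = map_mx ratr (map_mx q D) *m H.
  exact: map_mxM.
move=> i j.
have := close_mulmx 1%:M H (ltW d_gt0) closeD i j.
rewrite !mul1mx -/c => closeDH; apply: le_trans closeDH _.
by rewrite mulrAC ler_pdivrMr ?ltr_wpDl // ler_pM2l // lerDl.
Qed.

(** Both U B V^T = 0 and the vanishing of the prescribed entries of B are
    rational linear conditions on B. *)
Lemma rat_isotropic_dense (R : archiRealFieldType) m n k l (A : 'M[R]_(m, n))
    (U : 'M[rat]_(k, m)) (V : 'M[rat]_(l, n)) e :
  map_mx ratr U *m A *m (map_mx ratr V)^T = 0 -> 0 < e ->
  exists B : 'M[rat]_(m, n),
    [/\ U *m B *m V^T = 0, zeros_kept A B & close_mx e A (map_mx ratr B)].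
Proof.
move=> UAV e_gt0.
pose Z := diag_mx (mxvec (\matrix_(i < m, j < n) ((A i j == 0)%:R : rat))).
pose S := row_mx (lin_mx (mulmxr V^T \o mulmx U)) Z.
have AS : mxvec A *m map_mx ratr S = 0.
  rewrite map_row_mx mul_mx_row.
  rewrite (@map_lin_mx _ _ _ _ _ _ _ _ (mulmxr (map_mx ratr V)^T \o mulmx (map_mx ratr U))); last first.
    by move=> B; rewrite /= !map_mxM map_trmx.
  rewrite mul_vec_lin /= UAV linear0 map_diag_mx map_mxvec.
  rewrite [X in row_mx _ X](_ : _ = 0) ?row_mx0 //.
  apply/rowP => ij; case/mxvec_indexP: ij => i j.
  rewrite mul_mx_diag !mxE !mxvecE !mxE.
  by case: eqP => [->|_]; rewrite ?mul0r ?rmorph0 ?mulr0.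
have [y yS closey] := rat_kernel_dense AS e_gt0.
exists (vec_mx y); move: yS; rewrite mul_mx_row -row_mx0 => /eq_row_mx[yU yZ].
split.
- apply: (can_inj mxvecK); rewrite linear0 -yU -{2}(vec_mxK y).
  by rewrite mul_vec_lin.
- move=> i j Aij; have := congr1 (fun M : 'rV_(m * n) => M 0 (mxvec_index i j)) yZ.
  by rewrite mul_mx_diag -{1}(vec_mxK y) !mxE !mxvecE !mxE Aij eqxx mulr1.
- by move=> i j; have := closey 0 (mxvec_index i j); rewrite mxvecE !mxE.
Qed.

(** * Rational realizations by approximation *)
Definition realizable (R : realDomainType) m n (A : 'M[R]_(m, n)) (r : nat) :=
  exists B : 'M[rat]_(m, n), sign_pattern B = sign_pattern A /\ \rank B = r.

Lemma sgz_ratr (R : realFieldType) (q : rat) : sgz (ratr q : R) = sgz q.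
Proof. by rewrite /sgz ltrq0 fmorph_eq0. Qed.

Lemma sgz_near (R : realDomainType) (a b : R) : `|b - a| < `|a| -> sgz b = sgz a.
Proof.
case: (ltrgt0P a) => [a0|a0|->]; last by rewrite ltNge normr_ge0.
  rewrite ltr_distl => /andP[b0 _]; rewrite !gtr0_sgz //; lra.
rewrite ltr_distl => /andP[_ b0]; rewrite !ltr0_sgz //; lra.
Qed.

Lemma sign_pattern_lsc (R : realFieldType) m n (A : 'M[R]_(m, n)) :
  exists2 e, 0 < e & forall B, zeros_kept A B -> close_mx e A B ->
    sign_pattern B = sign_pattern A.
Proof.
pose f (ij : 'I_m * 'I_n) := if A ij.1 ij.2 == 0 then 1 else `|A ij.1 ij.2|.
have f_gt0 ij : 0 < f ij by rewrite /f; case: eqP => // /eqP; rewrite normr_gt0.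
pose e := (\big[Num.min/1]_ij f ij) / 2.
have e_gt0 : 0 < e by rewrite divr_gt0 // lt_bigmin.
exists e => // B zAB closeAB; apply/matrixP => i j; rewrite !mxE.
have [Aij|Aij] := eqVneq (A i j) 0; first by rewrite zAB // Aij.
apply: sgz_near; apply: le_lt_trans (closeAB i j) _.
have : \big[Num.min/1]_ij f ij <= f (i, j) by apply: bigmin_le_cond.
rewrite {2}/f (negPf Aij) /= => le_e.
have : 0 < `|A i j| by rewrite normr_gt0.
by rewrite -/e in le_e *; rewrite /e; lra.
Qed.

(** A rational matrix close to A and orthogonal to the rational pair has rank
    at least rank A by semicontinuity, and at most rank A by the dimensions of
    the pair. *)
Lemma realizable_of_approx (R : archiRealFieldType) m n (A : 'M[R]_(m, n)) :
  (forall e, 0 < e -> exists A' : 'M[R]_(m, n), [/\ close_mx e A A', zeros_kept A A'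
    & exists k l (U : 'M[rat]_(k, m)) (V : 'M[rat]_(l, n)),
      map_mx ratr U *m A' *m (map_mx ratr V)^T = 0 /\
      (m + n <= \rank A + \rank U + \rank V)%N]) ->
  realizable A (\rank A).
Proof.
move=> approxA.
have [e1 e1_gt0 rankP] := mxrank_lsc A; have [e2 e2_gt0 signP] := sign_pattern_lsc A.
pose e := Num.min e1 e2 / 2.
have e_gt0 : 0 < e by rewrite divr_gt0 // lt_min e1_gt0.
have [A' [closeA' zA' [k [l [U [V [UAV rUV]]]]]]] := approxA e e_gt0.
have [B [UBV zB closeB]] := rat_isotropic_dense UAV e_gt0.
have closeAB d : e + e <= d -> close_mx d A (map_mx ratr B).
  move=> ed i j; apply: le_trans ed; rewrite -(subrKA (A' i j)) addrC.
  by apply: le_trans (ler_normD _ _) (lerD _ _).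
have e2e : e + e = Num.min e1 e2 by rewrite /e; lra.
exists B; split.
  rewrite -(signP (map_mx ratr B)).
  - by apply/matrixP => i j; rewrite !mxE sgz_ratr.
  - by move=> i j Aij; rewrite mxE (zB i j) ?rmorph0 // zA'.
  - by apply: closeAB; rewrite e2e ge_min lexx orbT.
apply/eqP; rewrite eqn_leq; apply/andP; split.
  by have := mxrank_isotropic_le UBV; lia.
rewrite -(@mxrank_map _ R ratr _ _ B); apply/rankP/closeAB.
by rewrite e2e ge_min lexx.
Qed.

(** * Symmetries of the problem: transposition and positive scaling *)
Lemma realizable_trmx (R : realDomainType) m n (A : 'M[R]_(m, n)) r :
  realizable A^T r -> realizable A r.
Proof.
move=> [B [sB rB]]; exists B^T; rewrite mxrank_tr; split=> //.
apply/matrixP => i j; have := congr1 (fun M : 'M_(n, m) => M j i) sB.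
by rewrite !mxE.
Qed.

Lemma diag_mx_pos_unit (R : realFieldType) n (d : 'rV[R]_n) :
  (forall i, 0 < d 0 i) -> diag_mx d \in unitmx.
Proof.
move=> d_gt0; rewrite unitmxE det_diag unitfE.
by apply/prodf_neq0 => i _; rewrite gt_eqF.
Qed.

Lemma realizable_scale (R : realFieldType) m n (A : 'M[R]_(m, n)) (d : 'rV_m) (e : 'rV_n) r :
  (forall i, 0 < d 0 i) -> (forall j, 0 < e 0 j) ->
  realizable (diag_mx d *m A *m diag_mx e) r -> realizable A r.
Proof.
move=> d_gt0 e_gt0 [B [sB rB]]; exists B; split=> //; rewrite sB.
apply/matrixP => i j; rewrite mul_mx_diag mul_diag_mx !mxE.
by rewrite !sgzM (gtr0_sgz (d_gt0 i)) (gtr0_sgz (e_gt0 j)) mul1r mulr1.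
Qed.

Lemma invmx_diag_pos (R : realFieldType) n (d : 'rV[R]_n) :
  (forall i, 0 < d 0 i) ->
  invmx (diag_mx d) = diag_mx (map_mx GRing.inv d).
Proof.
move=> d_gt0; have dU := diag_mx_pos_unit d_gt0.
rewrite -[RHS](mulKmx dU) mulmx_diag.
rewrite (_ : diag_mx _ = 1%:M) ?mulmx1 // -diag_const_mx; congr diag_mx.
by apply/rowP => i; rewrite !mxE mulfV // gt_eqF.
Qed.

(** If (U, V) is isotropic for A, then (U D, V E) is isotropic for
    D^-1 A E^-1, which has the signs and the rank of A. *)
Lemma realizable_scaled (R : archiRealFieldType) m n k l k' l' (A : 'M[R]_(m, n))
    (U : 'M_(k, m)) (V : 'M_(l, n)) (d : 'rV_m) (e : 'rV_n)
    (U' : 'M[rat]_(k', m)) (V' : 'M[rat]_(l', n)) :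
  (forall i, 0 < d 0 i) -> (forall j, 0 < e 0 j) ->
  U *m A *m V^T = 0 ->
  (map_mx ratr U' <= U *m diag_mx d)%MS -> (map_mx ratr V' <= V *m diag_mx e)%MS ->
  (m + n <= \rank A + \rank U' + \rank V')%N ->
  realizable A (\rank A).
Proof.
move=> d_gt0 e_gt0 UAV /submxP[X eU] /submxP[Y eV] rUV.
have dU := diag_mx_pos_unit d_gt0; have eU' := diag_mx_pos_unit e_gt0.
pose B := invmx (diag_mx d) *m A *m invmx (diag_mx e).
have rB : \rank B = \rank A.
  by rewrite mxrankMfree ?row_free_unit ?unitmx_inv // eqmxMfull // row_full_unit unitmx_inv.
apply: (@realizable_scale _ _ _ _ (map_mx GRing.inv d) (map_mx GRing.inv e)).
- by move=> i; rewrite mxE invr_gt0.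
- by move=> i; rewrite mxE invr_gt0.
rewrite -!invmx_diag_pos // -/B -rB; apply: realizable_of_approx => eps eps_gt0.
exists B; split=> //; first by move=> i j; rewrite subrr normr0 ltW.
exists k', l', U', V'; rewrite rB; split=> //.
rewrite eU eV /B !trmx_mul tr_diag_mx !mulmxA (mulmxK dU).
by rewrite (mulmxKV eU') -(mulmxA X) -(mulmxA X) UAV mulmx0 mul0mx.
Qed.

Lemma coordmx_diag (R : comNzRingType) n (S : {set 'I_n}) (d : 'rV[R]_n) :
  coordmx R S *m diag_mx d = diag_mx (\row_i d 0 (enum_val i)) *m coordmx R S.
Proof.
apply/matrixP => i j; rewrite mul_mx_diag mul_diag_mx !mxE.
by case: eqP => [->|_]; rewrite ?mulr0 ?mul0r // mulrC.
Qed.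

Lemma col_mx_coord_scale (R : realFieldType) n p (S : {set 'I_n}) (L : 'M_(p, n)) (d : 'rV[R]_n) :
  (forall i, 0 < d 0 i) ->
  (col_mx (coordmx R S) L *m diag_mx d :=: col_mx (coordmx R S) (L *m diag_mx d))%MS.
Proof.
move=> d_gt0; rewrite mul_col_mx coordmx_diag.
apply: eqmx_trans (eqmx_sym (addsmxE _ _)) _; apply: eqmx_trans (addsmxE _ _).
apply: adds_eqmx => //; apply: eqmxMfull.
by rewrite row_full_unit diag_mx_pos_unit // => i; rewrite mxE.
Qed.

(** * Isotropic spaces one dimension above a coordinate subspace *)

(** One vector spans [U] modulo the coordinate subspace; dividing each of its
    nonzero entries by its absolute value leaves the signs. *)
Lemma rational_up_to_scale (R : realFieldType) n u (S : {set 'I_n}) (U : 'M[R]_n) :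
  (coordmx R S <= U)%MS -> \rank U = (#|S| + u)%N -> (u <= 1)%N ->
  exists (d : 'rV[R]_n) k (U' : 'M[rat]_(k, n)),
    (forall i, 0 < d 0 i) /\ (map_mx ratr U' :=: U *m diag_mx d)%MS.
Proof.
move=> sU rU u1.
have [L eL] := submx_complement sU (etrans rU (congr1 (addn^~ u) (esym (mxrank_coordmx R S)))).
pose d := \row_i (if [exists k, L k i != 0] then (\sum_k `|L k i|)^-1 else 1) : 'rV[R]_n.
have d_gt0 i : 0 < d 0 i.
  rewrite mxE; case: existsP => // -[k Lk]; rewrite invr_gt0 (bigD1 k) //=.
  by rewrite ltr_wpDr ?normr_gt0 ?sumr_ge0.
exists d, (#|S| + u)%N, (col_mx (coordmx _ S) (map_mx (fun x => (sgz x)%:~R) L)); split=> //.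
rewrite map_col_mx map_coordmx.
apply: eqmx_trans (eqmx_sym (eqmxMr (diag_mx d) eL)).
apply: eqmx_trans (eqmx_sym (col_mx_coord_scale _ _ d_gt0)).
rewrite (_ : map_mx _ _ = L *m diag_mx d) //.
apply/matrixP => k i; rewrite mul_mx_diag !mxE rmorph_int -sgrEz.
case: existsP => [[k' Lk']|noL]; last first.
  by have [->|Lk] := eqVneq (L k i) 0; rewrite ?sgr0 ?mul0r //; case: noL; exists k.
(* L has at most one row, as u <= 1. *)
have only k1 : k1 = k by case: u u1 k k1 {L eL d d_gt0 k' Lk' rU} => [|[|u]] // _ [[|k] ?] [[|k1] ?] //; apply: val_inj.
rewrite (bigD1 k) //= big1 ?addr0 => [|k1]; last by rewrite (only k1) eqxx.
rewrite (only k') in Lk'.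
by rewrite {2}[L k i]numEsg -mulrA divff ?normr_eq0 ?mulr1.
Qed.

(** * Isotropic spaces two dimensions above a coordinate subspace *)

(** Moving [x] to [x'] breaks only the second of the two linear relations
    satisfied by [a].  If [x] takes two different values on the support of
    [c * a], changing [a] at two such places restores it and keeps the first
    relation.  Otherwise both relations are proportional before and after the
    move, so [a] itself still satisfies them.  The lower bound [g] on the gaps
    of [x] keeps the correction small. *)
Lemma planar_column (R : realFieldType) n (c x x' a : 'I_n -> R) (delta g : R) :
  (forall i, c i = 0 \/ `|c i| = 1) ->
  (forall i, `|x' i - x i| <= delta) ->
  (forall i k, x i = x k -> x' i = x' k) ->
  (forall i k, x i != x k -> g <= `|x i - x k|) ->
  0 < g -> 4 * delta <= g -> 0 <= delta ->
  \sum_i c i * a i = 0 -> \sum_i c i * x i * a i = 0 ->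
  exists a' : 'I_n -> R,
    [/\ forall i, a i = 0 -> a' i = 0,
        forall i, `|a' i - a i| <= 2 * delta / g * \sum_i `|a i|,
        \sum_i c i * a' i = 0 & \sum_i c i * x' i * a' i = 0].
Proof.
move=> cP x'P x'x gapx g_gt0 le_g d_ge0 ca0 cxa0.
have bound_ge0 : 0 <= 2 * delta / g * \sum_i `|a i|.
  by rewrite mulr_ge0 ?sumr_ge0 // divr_ge0 ?mulr_ge0 // ltW.
pose P (ik : 'I_n * 'I_n) :=
  [&& c ik.1 * a ik.1 != 0, c ik.2 * a ik.2 != 0 & x ik.1 != x ik.2].
have [[i k]|noP] := pickP P; last first.
  exists a; split=> // [i|]; first by rewrite subrr normr0.
  (* All of the support of c * a lies over a single value of x. *)
  have [/= i0 ca_i0|ca_all0] := pickP (fun i => c i * a i != 0).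
    rewrite (eq_bigr (fun i => x' i0 * (c i * a i))) => [|i _].
      by rewrite -mulr_sumr ca0 mulr0.
    rewrite mulrAC mulrC; have [->|ca_i] := eqVneq (c i * a i) 0; first by rewrite !mulr0.
    congr (_ * _); apply: x'x; apply/eqP/negPn/negP => xi.
    by have := noP (i, i0); rewrite /P /= ca_i ca_i0 xi.
  by rewrite big1 // => i _; rewrite mulrAC; move/negPn/eqP: (ca_all0 i) => ->; rewrite mul0r.
rewrite /P /= !mulf_eq0 !negb_or => /and3P[/andP[ci ai] /andP[ck ak] xik].
have {cP}c2 h : c h != 0 -> c h * c h = 1 /\ `|c h| = 1.
  case: (cP h) => [->|ch _]; first by rewrite eqxx.
  by split=> //; rewrite -expr2 -real_normK ?num_real // ch expr1n.
have [ci2 ci1] := c2 i ci; have [ck2 ck1] := c2 k ck.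
have ik : i != k by apply: contraNneq xik => ->.
pose e := \sum_h c h * x' h * a h.
pose D := x' i - x' k.
have D_ge : g / 2 <= `|D|.
  have := gapx i k xik; have := x'P i; have := x'P k; rewrite /D.
  rewrite !ler_norml => /andP[? ?] /andP[? ?].
  case: (lerP 0 (x i - x k)) => xs; rewrite ?(ger0_norm xs) ?(ltr0_norm xs) => ?.
    by rewrite ger0_norm; lra.
  by rewrite ltr0_norm; lra.
have D_neq0 : D != 0 by rewrite -normr_gt0; apply: lt_le_trans D_ge; lra.
have e_le : `|e| <= delta * \sum_h `|a h|.
  have -> : e = \sum_h c h * (x' h - x h) * a h.
    rewrite -[LHS]subr0 -[X in _ - X]cxa0 -sumrB; apply: eq_bigr => h _; ring.
  rewrite mulr_sumr.
  apply: le_trans (ler_norm_sum _ _ _) (ler_sum _ _) => h _.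
  rewrite !normrM ler_wpM2r //.
  have [->|ch] := eqVneq (c h) 0; first by rewrite normr0 mul0r.
  by have [_ ->] := c2 h ch; rewrite mul1r.
pose b h := (if h == i then c i else 0) - (if h == k then c k else 0).
have sumb (f : 'I_n -> R) : \sum_h f h * b h = f i * c i - f k * c k.
  under eq_bigr do rewrite mulrBr.
  rewrite sumrB (bigD1 i) //= eqxx big1 ?addr0 => [|h /negPf->]; last by rewrite mulr0.
  rewrite (bigD1 k) //= eqxx big1 ?addr0 => [|h /negPf->]; last by rewrite mulr0.
  by [].
have suma (f : 'I_n -> R) :
    \sum_h f h * (a h - e / D * b h) = \sum_h f h * a h - e / D * (f i * c i - f k * c k).
  rewrite -sumb mulr_sumr -sumrB; apply: eq_bigr => h _; ring.
(* The correction b is orthogonal to c, and its pairing with c x' is D. *)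
exists (fun h => a h - e / D * b h); split.
- move=> h ah; rewrite ah /b; case: eqP => [hi|_]; first by rewrite -hi ah eqxx in ai.
  case: eqP => [hk|_]; first by rewrite -hk ah eqxx in ak.
  by rewrite subrr mulr0 subrr.
- move=> h; rewrite addrAC subrr sub0r normrN normrM.
  have b_le : `|b h| <= 1.
    rewrite /b; have [->|_] := eqVneq h i; first by rewrite (negPf ik) subr0 ci1.
    by rewrite sub0r normrN; case: eqP; rewrite ?ck1 ?normr0.
  apply: le_trans (ler_piMr _ b_le) _ => //.
  rewrite normrM normfV ler_pdivrMr ?normr_gt0 //.
  apply: le_trans e_le _; rewrite -(ler_pM2l g_gt0).
  have -> : g * (2 * delta / g * (\sum_i0 `|a i0|) * `|D|) =
      delta * (\sum_i0 `|a i0|) * (2 * `|D|).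
    by field; rewrite gt_eqF.
  rewrite mulrC ler_wpM2l ?mulr_ge0 ?sumr_ge0 //; lra.
- by rewrite suma ca0 ci2 ck2 subrr mulr0 subrr.
- rewrite suma -/e (mulrAC (c i)) ci2 (mulrAC (c k)) ck2 !mul1r -/D.
  by rewrite divfK // subrr.
Qed.

(** Column [i] is s i (1, x i): the points of the projective line given by the
    columns of a two-row matrix, in an affine chart with signs. *)
Definition planarmx (R : nzRingType) n (s : 'I_n -> int) (x : 'I_n -> R) : 'M[R]_(2, n) :=
  \matrix_(k, i) ((s i)%:~R * x i ^+ k).

Lemma planarmx_mul0 (R : nzRingType) n (s : 'I_n -> int) (x : 'I_n -> R) p
    (A : 'M_(n, p)) (j : 'I_p) :
  (forall k, (planarmx s x *m A) k j = 0) <->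
  \sum_i (s i)%:~R * A i j = 0 /\ \sum_i (s i)%:~R * x i * A i j = 0.
Proof.
have row0 : (planarmx s x *m A) 0 j = \sum_i (s i)%:~R * A i j.
  by rewrite mxE; apply: eq_bigr => i _; rewrite mxE mulr1.
have row1 : (planarmx s x *m A) 1 j = \sum_i (s i)%:~R * x i * A i j.
  by rewrite mxE; apply: eq_bigr => i _; rewrite mxE expr1.
rewrite -row0 -row1; split=> [//|[H0 H1] [[|[|k]] ?] //].
  by rewrite -[RHS]H0; congr (_ _ j); apply: val_inj.
by rewrite -[RHS]H1; congr (_ _ j); apply: val_inj.
Qed.

Lemma planar_perturbation (R : archiRealFieldType) m n (s : 'I_m -> int)
    (x : 'I_m -> R) (A : 'M[R]_(m, n)) (e : R) :
  (forall i, s i = 0 \/ `|s i| = 1) -> 0 < e ->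
  exists (q : 'I_m -> rat) (A' : 'M[R]_(m, n)),
    [/\ close_mx e (planarmx s x) (map_mx ratr (planarmx s q)),
        close_mx e A A', zeros_kept A A' &
        forall j, (forall k, (planarmx s x *m A) k j = 0) ->
          forall k, (map_mx ratr (planarmx s q) *m A') k j = 0].
Proof.
move=> sP e_gt0.
have sRP i : ((s i)%:~R : R) = 0 \/ `|(s i)%:~R : R| = 1.
  by case: (sP i) => si; [left|right]; rewrite -?intr_norm si.
have [g g_gt0 gapx] : exists2 g, 0 < g & forall i k, x i != x k -> g <= `|x i - x k|.
  pose f (ik : 'I_m * 'I_m) := if x ik.1 == x ik.2 then 1 else `|x ik.1 - x ik.2|.
  exists (\big[Num.min/1]_ik f ik) => [|i k xik].
    rewrite lt_bigmin // => ik _; rewrite /f; case: eqP => // /eqP.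
    by rewrite normr_gt0 subr_eq0.
  have : \big[Num.min/1]_ik f ik <= f (i, k) by apply: bigmin_le_cond.
  by rewrite {2}/f /= (negPf xik).
pose C := \sum_j \sum_i `|A i j|.
have C_ge0 : 0 <= C by apply: sumr_ge0 => ? _; apply: sumr_ge0.
(* The three bounds make the new points close to the old ones, preserve half
   of each gap, and make the correction of each column at most e. *)
pose delta := Num.min e (Num.min (g / 4) (e * g / (2 * (C + 1)))).
have C1_gt0 : 0 < C + 1 by rewrite ltr_wpDl.
have delta_gt0 : 0 < delta.
  by rewrite !lt_min e_gt0 !divr_gt0 ?mulr_gt0.
have [delta_e [delta_g delta_C]] : delta <= e /\ 4 * delta <= g /\
    2 * delta / g * C <= e.
  have : delta <= delta by [].
  rewrite {2}/delta !le_min => /and3P[? d_g d_C]; split=> //; split; first lra.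
  rewrite mulrAC ler_pdivrMr //.
  move: d_C; rewrite ler_pdivlMr ?mulr_gt0 // => d_C.
  by apply: le_trans d_C; nra.
have [q0 q0P] := rat_approx delta_gt0.
pose q i := q0 (x i).
have mapP : map_mx ratr (planarmx s q) = planarmx s (fun i => ratr (q i)) :> 'M[R]_(2, m).
  by apply/matrixP => k i; rewrite !mxE rmorphM rmorphXn /= ratr_int.
have colP (j : 'I_n) : exists a' : 'I_m -> R,
    [/\ forall i, A i j = 0 -> a' i = 0, forall i, `|a' i - A i j| <= e &
     (forall k, (planarmx s x *m A) k j = 0) ->
     \sum_i (s i)%:~R * a' i = 0 /\ \sum_i (s i)%:~R * ratr (q i) * a' i = 0].
  have [Lj0|] := boolP [forall k, (planarmx s x *m A) k j == 0]; last first.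
    move=> notL; exists (A^~ j); split=> // [i|]; first by rewrite subrr normr0 ltW.
    by move=> L0; case/negP: notL; apply/forallP => k; apply/eqP.
  have /planarmx_mul0[Lj1 Lj2] : forall k, (planarmx s x *m A) k j = 0.
    by move=> k; apply/eqP/(forallP Lj0).
  have qx i k : x i = x k -> ratr (q i) = ratr (q k) :> R by rewrite /q => ->.
  have [a' [za' ca' a'1 a'2]] := planar_column sRP (fun i => q0P (x i)) qx gapx g_gt0
    delta_g (ltW delta_gt0) Lj1 Lj2.
  exists a'; split=> // i; apply: le_trans (ca' i) _; apply: le_trans delta_C.
  apply: ler_wpM2l; first by rewrite divr_ge0 ?mulr_ge0 ?ltW.
  rewrite /C [leRHS](bigD1 j) //= lerDl.
  by apply: sumr_ge0 => ? _; apply: sumr_ge0.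
have [A' A'P] := fin_all_exists colP.
exists q, (\matrix_(i, j) A' j i); split.
- rewrite mapP => k i; rewrite !mxE /=; case: k => [[|[|k]] ? //=].
    by rewrite subrr normr0 ltW.
  rewrite !expr1 -mulrBr normrM; apply: le_trans (le_trans (q0P (x i)) delta_e).
  by rewrite ler_piMl //; case: (sRP i) => ->; rewrite ?normr0.
- by move=> i j; rewrite mxE; have [_ ? _] := A'P j.
- by move=> i j Aij; rewrite mxE; have [zA' _ _] := A'P j; apply: zA'.
- move=> j /(let: And3 _ _ H := A'P j in H)[A'1 A'2].
  rewrite mapP; apply/planarmx_mul0; split.
    by rewrite -[RHS]A'1; apply: eq_bigr => i _; rewrite mxE.
  by rewrite -[RHS]A'2; apply: eq_bigr => i _; rewrite mxE.
Qed.

(** The first row is replaced by itself plus [t] times the second, where [t] is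
    so large that the new first entry of each nonzero column is nonzero; then
    each column is divided by the absolute value of that entry. *)
Lemma planar_normal_form (R : realFieldType) n (L : 'M[R]_(2, n)) :
  exists (d : 'rV[R]_n) (s : 'I_n -> int) (x : 'I_n -> R),
    [/\ forall i, 0 < d 0 i, forall i, s i = 0 \/ `|s i| = 1
      & (L *m diag_mx d :=: planarmx s x)%MS].
Proof.
(* A forbidden value of t is some - L 0 i / L 1 i; this t exceeds them all. *)
pose t := 1 + \sum_i `|L 0 i / L 1 i|.
pose w i := L 0 i + t * L 1 i.
have w0 i : w i = 0 -> L 1 i = 0.
  rewrite /w; have [//|L1] := eqVneq (L 1 i) 0.
  move=> /eqP; rewrite addr_eq0 => /eqP L0.
  suff : `|L 0 i / L 1 i| < t by rewrite L0 mulNr mulfK // normrN ltNge ler_norm.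
  rewrite /t (bigD1 i) //= addrCA ltrDl ltr_wpDr // ?sumr_ge0 //.
pose d := \row_i (if w i == 0 then 1 else `|w i|^-1) : 'rV[R]_n.
have d_gt0 i : 0 < d 0 i.
  by rewrite mxE; case: eqP => // /eqP wi; rewrite invr_gt0 normr_gt0.
exists d, (fun i => sgz (w i)), (fun i => L 1 i / w i); split=> //.
  by move=> i; case: sgzP => _; rewrite ?normrN ?normr1; [left|right|right].
pose G := 1%:M + t *: delta_mx 0 1 : 'M[R]_2.
have G_unit : G \in unitmx.
  (* The square of [delta_mx 0 1] is zero. *)
  have GK : G *m (1%:M - t *: delta_mx 0 1) = 1%:M.
    rewrite mulmxBr mulmx1 -scalemxAr mulmxDl mul1mx -scalemxAl mul_delta_mx_0 //.
    by rewrite scaler0 addr0 addrK.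
  by have [] := mulmx1_unit GK.
suff -> : planarmx (fun i => sgz (w i)) (fun i => L 1 i / w i) = G *m (L *m diag_mx d).
  by apply: eqmx_sym; apply: eqmxMfull; rewrite row_full_unit.
apply/matrixP => k i; rewrite mulmxA mul_mx_diag !mxE -sgrEz.
rewrite !big_ord_recl big_ord0 !mxE /= addr0.
have -> : lift ord0 ord0 = 1 :> 'I_2 by apply: val_inj.
rewrite -[ord0]/(0 : 'I_2).
have sgw : Num.sg (w i) = w i * (if w i == 0 then 1 else `|w i|^-1).
  have [->|wi] := eqVneq (w i) 0; first by rewrite sgr0 mul0r.
  by rewrite {2}[w i]numEsg -mulrA divff ?normr_eq0 ?mulr1.
case: k => [[|[|k]] ?] //=; rewrite ?expr0 ?expr1 !(mulr0, addr0, add0r, mul1r, mul0r, mulr1).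
  exact: sgw.
have [wi|wi] := eqVneq (w i) 0; first by rewrite (w0 i wi) !(mul0r, mulr0).
by rewrite sgw (negPf wi) mulrC mulrA divfK.
Qed.

(** Semicontinuity of the rank is used twice: for A, and for the matrix W that
    spans the scaled U, so that the perturbed space does not lose dimension. *)
Lemma realizable_planar (R : archiRealFieldType) m n (A : 'M[R]_(m, n)) (S : {set 'I_m})
    (T : {set 'I_n}) (U : 'M_m) :
  (coordmx R S <= U)%MS -> \rank U = (#|S| + 2)%N ->
  U *m A *m (coordmx R T)^T = 0 -> (\rank A + \rank U + #|T| = m + n)%N ->
  realizable A (\rank A).
Proof.
move=> sU rU UAT rUA.
have [L eL] := submx_complement sU (etrans rU (congr1 (addn^~ 2) (esym (mxrank_coordmx R S)))).
have [d [s [x [d_gt0 sP eLd]]]] := planar_normal_form L.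
have dU := diag_mx_pos_unit d_gt0.
pose W := col_mx (coordmx R S) (planarmx s x).
have eW : (W :=: U *m diag_mx d)%MS.
  apply: eqmx_sym; apply: eqmx_trans (eqmxMr (diag_mx d) eL) _.
  apply: eqmx_trans (col_mx_coord_scale _ _ d_gt0) _.
  apply: eqmx_trans (eqmx_sym (addsmxE _ _)) _; apply: eqmx_trans (addsmxE _ _).
  exact: adds_eqmx.
pose B := invmx (diag_mx d) *m A.
have rB : \rank B = \rank A by rewrite eqmxMfull // row_full_unit unitmx_inv.
have rW : \rank W = \rank U by rewrite eW mxrankMfree // row_free_unit.
have WB0 : W *m B *m (coordmx R T)^T = 0.
  have /submxP[X ->] : (W <= U *m diag_mx d)%MS by rewrite eW.
  by rewrite /B !mulmxA mulmxK // -(mulmxA X) -(mulmxA X) UAT mulmx0.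
apply: (@realizable_scale _ _ _ _ (map_mx GRing.inv d) (const_mx 1)) => [i|j|].
- by rewrite mxE invr_gt0.
- by rewrite mxE.
rewrite diag_const_mx mulmx1 -invmx_diag_pos // -/B -rB.
apply: realizable_of_approx => e e_gt0.
have [e1 e1_gt0 rWP] := mxrank_lsc W.
have e2_gt0 : 0 < Num.min e e1 by rewrite lt_min e_gt0.
have [q [B' [closeq closeB zB B'P]]] := planar_perturbation x B sP e2_gt0.
exists B'; split=> //.
  by move=> i j; apply: le_trans (closeB i j) _; rewrite ge_min lexx.
pose U' := col_mx (coordmx rat S) (planarmx s q).
exists (#|S| + 2)%N, #|T|, U', (coordmx _ T); split; last first.
  suff : (\rank U <= \rank U')%N by rewrite rB mxrank_coordmx; lia.
  rewrite -rW -(@mxrank_map _ R ratr _ _ U'); apply: rWP => i j.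
  rewrite map_col_mx map_coordmx /W.
  rewrite -[i]splitK; case: (split i) => k /=.
    by rewrite !col_mxEu subrr normr0 ltW.
  by rewrite !col_mxEd; apply: le_trans (closeq k j) _; rewrite ge_min lexx orbT.
move/eqP: WB0; rewrite /W !mul_col_mx col_mx_eq0 mul_coordmx !mul_mx_coordmxT.
move=> /andP[/eqP SBT /eqP LBT].
rewrite map_col_mx !map_coordmx !mul_col_mx mul_coordmx !mul_mx_coordmxT.
apply/eqP; rewrite col_mx_eq0; apply/andP; split; apply/eqP/matrixP => i j.
  rewrite !mxE; apply: zB.
  by have := congr1 (fun M : 'M_(_, _) => M i j) SBT; rewrite !mxE.
rewrite [LHS]mxE [RHS]mxE; apply: B'P => k.
by have := congr1 (fun M : 'M_(_, _) => M k j) LBT; rewrite [LHS]mxE [RHS]mxE.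
Qed.

(** * Matrices with a large zero block *)

(** The dimensions of the extended isotropic pair exceed those of the given
    coordinate pair by at most two in total, which leaves the planar case, its
    transpose, and the case of at most one extra dimension on each side. *)
Lemma realizable_zero_block (R : archiRealFieldType) m n (A : 'M[R]_(m, n))
    (S : {set 'I_m}) (T : {set 'I_n}) :
  coordmx R S *m A *m (coordmx R T)^T = 0 ->
  (m + n <= \rank A + #|S| + #|T| + 2)%N ->
  realizable A (\rank A).
Proof.
move=> SAT STlarge.
have [U [V [sU sV UAV rUAV]]] := isotropic_extension SAT.
have := mxrankS sU; have := mxrankS sV; rewrite !mxrank_coordmx => TV SU.
have [u rU] : exists u, \rank U = (#|S| + u)%N.
  by exists (\rank U - #|S|)%N; rewrite subnKC.
have [v rV] : exists v, \rank V = (#|T| + v)%N.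
  by exists (\rank V - #|T|)%N; rewrite subnKC.
have uv2 : (u + v <= 2)%N by move: STlarge; rewrite -rUAV rU rV; lia.
have [u2|u2] := eqVneq u 2%N.
  rewrite u2 in rU uv2; apply: (realizable_planar (T := T) sU rU); last by lia.
  by move/submxP: sV => [X ->]; rewrite trmx_mul mulmxA UAV mul0mx.
have [v2|v2] := eqVneq v 2%N.
  rewrite v2 in rV uv2; apply: realizable_trmx; rewrite -mxrank_tr.
  apply: (realizable_planar (T := S) sV rV); last by rewrite mxrank_tr; lia.
  move/submxP: sU => [X ->]; rewrite trmx_mul mulmxA.
  have -> : V *m A^T *m U^T = 0 by apply: trmx_inj; rewrite !trmx_mul !trmxK mulmxA UAV trmx0.
  by rewrite mul0mx.
have [d [k [U' [d_gt0 eU]]]] : exists (d : 'rV[R]_m) k (U' : 'M[rat]_(k, m)),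
    (forall i, 0 < d 0 i) /\ (map_mx ratr U' :=: U *m diag_mx d)%MS.
  by apply: rational_up_to_scale sU rU _; lia.
have [e [l [V' [e_gt0 eV]]]] : exists (d : 'rV[R]_n) k (U' : 'M[rat]_(k, n)),
    (forall i, 0 < d 0 i) /\ (map_mx ratr U' :=: V *m diag_mx d)%MS.
  by apply: rational_up_to_scale sV rV _; lia.
apply: (realizable_scaled (U' := U') (V' := V') d_gt0 e_gt0 UAV).
- by rewrite eU.
- by rewrite eV.
rewrite -(@mxrank_map _ R ratr _ _ U') -(@mxrank_map _ R ratr _ _ V') eU eV.
by rewrite !mxrankMfree ?row_free_unit ?diag_mx_pos_unit // rUAV.
Qed.

(** The rows and columns outside a cover meet in a zero block. *)
Lemma cover_zero_block (R : comNzRingType) m n (A : 'M[R]_(m, n)) (L : {set 'I_m + 'I_n}) :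
  covers_nonzeros A L ->
  exists (S : {set 'I_m}) (T : {set 'I_n}),
    coordmx R S *m A *m (coordmx R T)^T = 0 /\ (m + n = #|L| + (#|S| + #|T|))%N.
Proof.
move=> covL.
pose P := [set i | inl i \in L]; pose Q := [set j | inr j \in L].
exists (~: P), (~: Q); split.
  rewrite mul_coordmx mul_mx_coordmxT; apply/matrixP => i j; rewrite !mxE.
  have := enum_valP i; have := enum_valP j; rewrite !inE => jL iL.
  apply/eqP/negPn/negP => Aij.
  move/forallP/(_ (enum_val i))/forallP/(_ (enum_val j)): covL.
  by rewrite Aij (negPf iL) (negPf jL).
have -> : #|L| = (#|P| + #|Q|)%N.
  rewrite -!sum1_card big_sumType /=.
  by congr (_ + _)%N; apply: eq_bigl => i; rewrite inE.
by rewrite addnACA !cardsC !card_ord.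
Qed.

Theorem theorem3p6 (R : realType) (m n t : nat) (A : 'M[R]_(m, n)) :
  term_rank A = t ->
  (t - 2 <= \rank A)%N ->
  exists B : 'M[rat]_(m, n),
    sign_pattern B = sign_pattern A /\ \rank B = \rank A.
Proof.
move=> <- rA; have [[L covL cL] _] := term_rankP A.
have [S [T [SAT cST]]] := cover_zero_block covL.
apply: (realizable_zero_block SAT); move: rA; rewrite cST -cL leq_subLR.
by rewrite -(addnA (\rank A)) addnAC leq_add2r addnC.
Qed.
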